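(* Let $N\ge2$, let $\mathcal{G}_{\mathrm{new}}=(G_{[1]},\dots,G_{[N]})$ be the time-evolving network on the node set $[n]$ obtained from $\mathcal{G}=(G_{[1]},\dots,G_{[N-1]})$ via the addition of a single final $N$-th time frame, and let $\mathcal{A}_{\mathrm{old}}$ and $$\mathcal{A}_{\mathrm{new}}=\begin{bmatrix}\mathcal{A}_{\mathrm{old}}&\boldsymbol{A_{[N]}}\\0&A_{[N]}\end{bmatrix}$$ be the time-evolving adjacency matrices of $\mathcal{G}$ and $\mathcal{G}_{\mathrm{new}}$, where a boldface $\boldsymbol{Y}$ denotes the block column vector consisting of $N-1$ copies of the $n\times n$ matrix $Y$. Let $0<t<t_0(\mathcal{A}_{\mathrm{new}})$ be such that $\Psi(\mathcal{A}_{\mathrm{new}},t)=\sum_{k\ge0}t^kP_k(\mathcal{A}_{\mathrm{new}})$ converges. Define $Z_{\mathrm{old}}:=t\mathcal{A}_{\mathrm{old}}\ast(E-t^2\mathcal{A}_{\mathrm{old}}^{\ast T}\ast\mathcal{A}_{\mathrm{old}})^{\ast(-1)}$, $Z_N:=tA_{[N]}\ast(\mathbf{1}\mathbf{1}^T-t^2A_{[N]}^{\ast T}\ast A_{[N]})^{\ast(-1)}$, and $$\begin{aligned}X=&-Z_{\mathrm{old}}\ast t\mathcal{A}_{\mathrm{old}}^{\ast T}\ast\boldsymbol{Z_N}-Z_{\mathrm{old}}\ast t\boldsymbol{A_{[N]}}^{\ast T}\ast Z_N\\&+\mathrm{dd}^\ast\Big[t\mathcal{A}_{\mathrm{old}}\Big(Z_{\mathrm{old}}\ast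 t\mathcal{A}_{\mathrm{old}}^{\ast T}\ast\boldsymbol{Z_N}+Z_{\mathrm{old}}\ast t\boldsymbol{A_{[N]}}^{\ast T}\ast Z_N+\boldsymbol{Z_N}\Big)\Big]-\boldsymbol{Z_N}+\mathrm{dd}^\ast\big(t\boldsymbol{A_{[N]}}Z_N\big).\end{aligned}$$ Then $$\Psi(\mathcal{A}_{\mathrm{new}},t)=\begin{bmatrix}\Psi(\mathcal{A}_{\mathrm{old}},t)&-\Psi(\mathcal{A}_{\mathrm{old}},t)\,X\,\Psi(A_{[N]},t)\\0&\Psi(A_{[N]},t)\end{bmatrix}.$$
   Context: A finite time-evolving network $(G_{[1]},\dots,G_{[M]})$ on $V=[n]=\{1,\dots,n\}$ is a finite sequence of weighted digraphs $G_{[s]}=(V,E_{[s]})$, $E_{[s]}\subseteq V\times V$ (loops allowed), with weight functions $\omega_{[s]}:E_{[s]}\to\mathbb{R}_{>0}$. The adjacency matrix $A_{[s]}\in\mathbb{R}^{n\times n}$ has $(v,w)$ entry $\omega_{[s]}(v,w)$ if $(v,w)\in E_{[s]}$ and $0$ otherwise. The time-evolving adjacency matrix $\mathcal{A}\in\mathbb{R}^{nM\times nM}$ is the block matrix with $n\times n$ blocks whose $(r,s)$ block is $A_{[s]}$ if $r\le s$ and $0$ if $r>s$. The matrix $A_{[N]}$ alone is the time-evolving adjacency matrix of the one-frame network $(G_{[N]})$. A walk of length $k\ge1$ is a sequence of nodes $i_1\dots i_{k+1}$ together with time frames $\sigma_1\le\dots\le\sigma_k$ of the network such that $(i_\ell,i_{\ell+1})\in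 E_{[\sigma_\ell]}$ for $\ell=1,\dots,k$; its weight is $\prod_{\ell=1}^k\omega_{[\sigma_\ell]}(i_\ell,i_{\ell+1})$. It is backtracking if $i_l=i_{l+2}$ for some $1\le l\le k-1$, and nonbacktracking otherwise. It begins on frame $\sigma_1$ and ends on frame $\sigma_k$. For a time-evolving adjacency matrix $\mathcal{A}$: $P_0(\mathcal{A})=I$ and, for $k\ge1$, $P_k(\mathcal{A})$ is the block matrix whose $(\tau_1,\tau_2)$ block has as $(i,j)$ entry the sum of the weights of all nonbacktracking walks of length $k$ from node $i$ to node $j$ in the corresponding network that begin on a time frame $\ge\tau_1$ and end on time frame $\tau_2$. $\Psi(\mathcal{A},t):=\sum_{k=0}^\infty t^kP_k(\mathcal{A})$. Also $t_0(\mathcal{A}):=\big(\max_{i,j,s}(A_{[s]})_{ij}(A_{[s]})_{ji}\big)^{-1/2}$, the maximum being over nodes $i,j$ and the frames $s$ of the network, with $t_0(\mathcal{A})=\infty$ if the maximum is $0$. Block matrices with $n\times n$ blocks are regarded as matrices over $R=(\mathbb{R}^{n\times n},+,\circ)$, $\circ$ being the entrywise product. For conformable block matrices, $(A\ast B)_{rs}=\sum_kA_{rk}\circ B_{ks}$, whereas juxtaposition denotes ordinary matrix multiplication. $E$ is the identity for $\ast$ (block diagonal with all diagonal blocks equal to the all-ones matrix $\mathbf{1}\mathbf{1}^T$; for a single block it is $\mathbf{1}\mathbf{1}^T$), and $M^{\ast(-1)}$ is the inverse with respect to $\ast$. $A^{\ast T}$ is obtained by transposing each block in place, $(A^{\ast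 T})_{rs}=(A_{rs})^T$ (so $\boldsymbol{A_{[N]}}^{\ast T}$ is the block column of $N-1$ copies of $A_{[N]}^T$). $\mathrm{dd}^\ast(A)$ has blocks $\mathrm{dd}(A_{rs})$, where $\mathrm{dd}(X)$ is the diagonal matrix with the same diagonal as $X$. *)

(* Defs.v *)
From HB Require Import structures.
From mathcomp Require Import all_boot all_order all_algebra.
From mathcomp Require Import all_classical all_reals all_analysis.

Set Implicit Arguments.
Unset Strict Implicit.
Unset Printing Implicit Defensive.

Import Order.TTheory GRing.Theory Num.Theory.
Import numFieldNormedType.Exports.

Local Open Scope classical_set_scope.
Local Open Scope ring_scope.

(* The values of [wd_weight] off [wd_edge] are irrelevant. *)
Record wdigraph (R : realType) (n : nat) := WDigraph {
  wd_edge : rel 'I_n;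
  wd_weight : 'I_n -> 'I_n -> R;
  wd_weight_gt0 : forall v w, wd_edge v w -> 0 < wd_weight v w
}.

Definition wd_adj (R : realType) (n : nat) (G : wdigraph R n) : 'M[R]_n :=
  \matrix_(v, w) (if wd_edge G v w then wd_weight G v w else 0).

(* Time frames are numbered from 0 and nodes from 0. *)
Definition network (R : realType) (n M : nat) := 'I_M -> wdigraph R n.

Definition one_frame (R : realType) (n : nat) (H : wdigraph R n) :
    network R n 1 := fun=> H.

Definition add_frame (R : realType) (n M : nat) (G : network R n M)
    (H : wdigraph R n) : network R n (M + 1) :=
  fun s => match fintype.split s with inl r => G r | inr _ => H end.

(* A real (p n) x (q n) matrix with n x n blocks is represented by the p x q
   array of its blocks, of type ['M['M[R]_n]_(p, q)]. Since ['M[R]_n] carries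
   the usual matrix ring structure, [*m], [+] and [1%:M] at this type are the
   ordinary (block) product, sum and identity. *)
Section BlockMatrices.
Variables (R : realType) (n : nat).

Definition hadamard (X Y : 'M[R]_n) : 'M[R]_n := map2_mx *%R X Y.

Definition bscale (p q : nat) (t : R) (A : 'M['M[R]_n]_(p, q)) :
    'M['M[R]_n]_(p, q) :=
  \matrix_(r, s) (t *: A r s).

Definition starmul (p q u : nat) (A : 'M['M[R]_n]_(p, q))
    (B : 'M['M[R]_n]_(q, u)) : 'M['M[R]_n]_(p, u) :=
  \matrix_(r, s) \sum_k hadamard (A r k) (B k s).

Definition starid (p : nat) : 'M['M[R]_n]_p :=
  \matrix_(r, s) (if r == s then const_mx 1 else 0).

Definition is_starinv (p : nat) (A B : 'M['M[R]_n]_p) : Prop :=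
  starmul A B = starid p /\ starmul B A = starid p.

Definition star_invertible (p : nat) (A : 'M['M[R]_n]_p) : Prop :=
  exists B, is_starinv A B.

(* The inverse for [starmul], and 0 if there is none. *)
Definition starinv (p : nat) (A : 'M['M[R]_n]_p) : 'M['M[R]_n]_p :=
  xget 0 [set B | is_starinv A B].

Definition startr (p q : nat) (A : 'M['M[R]_n]_(p, q)) : 'M['M[R]_n]_(p, q) :=
  \matrix_(r, s) (A r s)^T.

Definition ddiag (X : 'M[R]_n) : 'M[R]_n := diag_mx (\row_i X i i).

Definition stardd (p q : nat) (A : 'M['M[R]_n]_(p, q)) : 'M['M[R]_n]_(p, q) :=
  \matrix_(r, s) ddiag (A r s).

Definition bcol (p : nat) (Y : 'M['M[R]_n]_1) : 'M['M[R]_n]_(p, 1) :=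
  const_mx (Y 0 0).

Definition Zden (p : nat) (t : R) (A : 'M['M[R]_n]_p) : 'M['M[R]_n]_p :=
  starid p - bscale (t ^+ 2) (starmul (startr A) A).

Definition Zmx (p : nat) (t : R) (A : 'M['M[R]_n]_p) : 'M['M[R]_n]_p :=
  starmul (bscale t A) (starinv (Zden t A)).

Definition Xmx (p : nat) (t : R) (Aold : 'M['M[R]_n]_p)
    (AN : 'M['M[R]_n]_1) : 'M['M[R]_n]_(p, 1) :=
  let Zold := Zmx t Aold in
  let ZN := Zmx t AN in
  let Y1 := starmul (starmul Zold (bscale t (startr Aold))) (bcol p ZN) in
  let Y2 := starmul (starmul Zold (bscale t (startr (bcol p AN)))) ZN in
  - Y1 - Y2 + stardd (bscale t Aold *m (Y1 + Y2 + bcol p ZN))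
  - bcol p ZN + stardd (bscale t (bcol p AN) *m ZN).

End BlockMatrices.

Section Networks.
Variables (R : realType) (n M : nat).
Implicit Types G : network R n M.

Definition tadj G : 'M['M[R]_n]_M :=
  \matrix_(r, s) (if (r <= s)%N then wd_adj (G s) else 0).

(* A walk of length k is given by its k + 1 nodes [x] and k frames [f]; its
   l-th step, l < k, goes from [wsrc x l] to [wtgt x l] on frame [tnth f l]. *)
Definition wsrc (k : nat) (x : k.+1.-tuple 'I_n) (l : 'I_k) : 'I_n :=
  tnth x (widen_ord (leqnSn k) l).

Definition wtgt (k : nat) (x : k.+1.-tuple 'I_n) (l : 'I_k) : 'I_n :=
  tnth x (lift ord0 l).

Definition is_walk G (k : nat) (x : k.+1.-tuple 'I_n) (f : k.-tuple 'I_M) :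
    bool :=
  [forall l, wd_edge (G (tnth f l)) (wsrc x l) (wtgt x l)] &&
  sorted leq [seq val s | s <- f].

Definition walk_weight G (k : nat) (x : k.+1.-tuple 'I_n)
    (f : k.-tuple 'I_M) : R :=
  \prod_(l < k) wd_weight (G (tnth f l)) (wsrc x l) (wtgt x l).

Definition backtracking (k : nat) (x : k.+1.-tuple 'I_n) : bool :=
  [exists a : 'I_k.+1, exists b : 'I_k.+1,
    (b == a.+2 :> nat) && (tnth x a == tnth x b)].

(* Weights are positive on edges, so the network can be recovered from its
   time-evolving adjacency matrix; P_k, Psi and t_0 are given here as functions
   of the network. *)
Definition Pmx G (k : nat) : 'M['M[R]_n]_M :=
  match k with
  | 0 => 1%:M
  | k'.+1 => \matrix_(tau1, tau2) \matrix_(i, j)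
      \sum_(w : (k'.+2.-tuple 'I_n * k'.+1.-tuple 'I_M)%type |
            [&& is_walk G w.1 w.2, ~~ backtracking w.1,
                tnth w.1 ord0 == i, tnth w.1 ord_max == j,
                (tau1 <= tnth w.2 ord0)%N & tnth w.2 ord_max == tau2])
        walk_weight G w.1 w.2
  end.

Definition Psi_partial G (t : R) : nat -> 'M['M[R]_n]_M :=
  series (fun k => bscale (t ^+ k) (Pmx G k)).

Definition Psi_converges G (t : R) : Prop := cvgn (Psi_partial G t).

Definition Psi G (t : R) : 'M['M[R]_n]_M := limn (Psi_partial G t).

(* All products in the maximum are nonnegative, so 0 is a harmless initial
   value. *)
Definition maxprod G : R :=
  \big[Num.max/0]_(i < n) \big[Num.max/0]_(j < n) \big[Num.max/0]_(s < M)
    (wd_adj (G s) i j * wd_adj (G s) j i).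

Definition t0 G : \bar R :=
  if maxprod G == 0 then +oo%E else ((maxprod G) `^ (- 2^-1))%:E.

End Networks.

Lemma tadj_add_frame (R : realType) (n M : nat) (G : network R n M)
    (H : wdigraph R n) :
  tadj (add_frame G H) =
  block_mx (tadj G) (bcol M (tadj (one_frame H))) 0 (tadj (one_frame H)).
Proof.
apply/matrixP => r s; rewrite mxE /add_frame.
case: (split_ordP r) => r' ->; case: (split_ordP s) => s' -> /=.
- by rewrite block_mxEul mxE.
- by rewrite block_mxEur !mxE (leq_trans (ltnW (ltn_ord r'))) ?leq_addr ?ord1.
- by rewrite block_mxEdl mxE leqNgt (leq_trans (ltn_ord s')) ?leq_addr.
- by rewrite block_mxEdr mxE leq_add2l.
Qed.

(* Main.v *)
Require Import Defs.
From HB Require Import structures.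
From mathcomp Require Import all_boot all_order all_algebra.
From mathcomp Require Import all_classical all_reals all_analysis.
Import Order.TTheory GRing.Theory Num.Theory.
Import numFieldNormedType.Exports.
Local Open Scope ring_scope.

(** The heart of the matter is that, for every network with time-evolving
    adjacency matrix A, the generating function Psi(A, t) has the explicit
    inverse L(A) = I - Z + dd*(t A Z) ([nbt_laplacian]).  Granting this, the
    theorem is inversion by blocks.  The new adjacency matrix is block upper
    triangular, hence so are Psi(A_new, t) ([Psi_add_frame]) and L(A_new), and
    the upper right block of L(A_new) is X ([nbt_laplacian_block]).  The upper
    right block of Psi(A_new, t) L(A_new) = I reads
    Psi(A_old, t) X + U L(A_N) = 0, where U is the unknown block of
    Psi(A_new, t); multiplying by Psi(A_N, t) on the right gives U.

    Why L(A) inverts Psi(A, t).  Fix a pair of nodes (i, j) and collect the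
    (i, j) entries of all blocks into one real M x M matrix, the slice of the
    block matrix at (i, j).  The product [starmul] is then the ordinary product
    slice by slice, so with T_ij the slice of t A, the slice of Z is
    Z_ij = T_ij (1 - T_ji T_ij)^-1.  Fix an initial node i, let Psi_v be the
    slice of Psi at (i, v), and let psi_uv be the part of Psi_v that comes from
    walks whose last step goes from u to v.  Deleting this last step leaves a
    nonbacktracking walk ending at u, and every such walk arises except those
    whose own last step goes from v to u.  Hence
      psi_uv = (Psi_u - psi_vu) T_uv.
    Together with the same equation for (v, u), this gives
    psi_uv = Psi_u Z_uv - Psi_v T_vu Z_uv; summing over u gives
      Psi_v = [i = v] + sum_u Psi_u Z_uv - Psi_v sum_u T_vu Z_uv,
    that is, Psi L = I ([Psi_mul_nbt_laplacian]).

    The matrices 1 - T_ji T_ij are invertible because they are triangular, with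
    diagonal entries 1 - t^2 (A_s)_ij (A_s)_ji that are positive for t < t_0
    ([Zden_unit], [t0_frame_lt1]).  Since all terms are nonnegative, convergence
    of Psi implies that of its parts psi_uv. *)

Set Implicit Arguments.
Unset Strict Implicit.
Unset Printing Implicit Defensive.

(** * Slices of block matrices *)

Section Slices.
Variables (R : realType) (n : nat).

(** A block matrix seen from a fixed pair of nodes: for fixed (i, j) the node
    indices are frozen and only the time frames are left. *)
Definition slice (p q : nat) (B : 'M['M[R]_n]_(p, q)) (i j : 'I_n) :
    'M[R]_(p, q) :=
  \matrix_(r, s) B r s i j.

Lemma sliceP (p q : nat) (A B : 'M['M[R]_n]_(p, q)) :
  (forall i j, slice A i j = slice B i j) -> A = B.
Proof.
move=> eqAB; apply/matrixP => r s; apply/matrixP => i j.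
by have /matrixP/(_ r s) := eqAB i j; rewrite !mxE.
Qed.

Lemma slice0 (p q : nat) i j : slice (0 : 'M['M[R]_n]_(p, q)) i j = 0.
Proof. by apply/matrixP => r s; rewrite !mxE. Qed.

Lemma slice1 (p : nat) i j : slice (1%:M : 'M['M[R]_n]_p) i j = (i == j)%:R%:M.
Proof.
apply/matrixP => r s; rewrite !mxE.
by case: (r == s); rewrite ?mulr1n ?mulr0n mxE.
Qed.

Lemma sliceD (p q : nat) (A B : 'M['M[R]_n]_(p, q)) i j :
  slice (A + B) i j = slice A i j + slice B i j.
Proof. by apply/matrixP => r s; rewrite !mxE. Qed.

Lemma sliceN (p q : nat) (A : 'M['M[R]_n]_(p, q)) i j :
  slice (- A) i j = - slice A i j.
Proof. by apply/matrixP => r s; rewrite !mxE. Qed.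

Lemma slice_bscale (p q : nat) t (A : 'M['M[R]_n]_(p, q)) i j :
  slice (bscale t A) i j = t *: slice A i j.
Proof. by apply/matrixP => r s; rewrite !mxE. Qed.

Lemma slice_mul (p q u : nat) (A : 'M['M[R]_n]_(p, q))
    (B : 'M['M[R]_n]_(q, u)) i j :
  slice (A *m B) i j = \sum_l slice A i l *m slice B l j.
Proof.
apply/matrixP => r s; rewrite !mxE !summxE.
under eq_bigr do rewrite mxE.
rewrite exchange_big; apply: eq_bigr => l _; rewrite mxE.
by apply: eq_bigr => k _; rewrite !mxE.
Qed.

Lemma slice_starmul (p q u : nat) (A : 'M['M[R]_n]_(p, q))
    (B : 'M['M[R]_n]_(q, u)) i j :
  slice (starmul A B) i j = slice A i j *m slice B i j.
Proof.
apply/matrixP => r s; rewrite !mxE !summxE.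
by apply: eq_bigr => k _; rewrite !mxE.
Qed.

Lemma slice_starid (p : nat) i j : slice (starid R n p) i j = 1%:M.
Proof. by apply/matrixP => r s; rewrite !mxE; case: eqP => _; rewrite mxE. Qed.

Lemma slice_startr (p q : nat) (A : 'M['M[R]_n]_(p, q)) i j :
  slice (startr A) i j = slice A j i.
Proof. by apply/matrixP => r s; rewrite !mxE. Qed.

Lemma slice_stardd (p q : nat) (A : 'M['M[R]_n]_(p, q)) i j :
  slice (stardd A) i j = if i == j then slice A i j else 0.
Proof.
apply/matrixP => r s; rewrite !mxE.
by case: eqP => [->|_]; rewrite !mxE ?mulr1n ?mulr0n.
Qed.

Lemma slice_bcol (p : nat) (Y : 'M['M[R]_n]_1) i j :
  slice (bcol p Y) i j = const_mx 1 *m slice Y i j.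
Proof. by apply/matrixP => r s; rewrite !mxE big_ord1 !mxE mul1r !ord1. Qed.

Lemma slice_block (p1 p2 q1 q2 : nat) (Aul : 'M['M[R]_n]_(p1, q1)) Aur Adl
    (Adr : 'M['M[R]_n]_(p2, q2)) i j :
  slice (block_mx Aul Aur Adl Adr) i j =
  block_mx (slice Aul i j) (slice Aur i j) (slice Adl i j) (slice Adr i j).
Proof.
apply/matrixP => r s; rewrite mxE.
by case: (split_ordP r) => r' ->; case: (split_ordP s) => s' ->;
   rewrite ?(block_mxEul, block_mxEur, block_mxEdl, block_mxEdr) mxE.
Qed.

Lemma slice_Zden (p : nat) t (A : 'M['M[R]_n]_p) i j :
  slice (Zden t A) i j =
  1%:M - (t *: slice A j i) *m (t *: slice A i j).
Proof.
rewrite /Zden sliceD sliceN slice_starid slice_bscale slice_starmul.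
by rewrite slice_startr -scalemxAl -scalemxAr scalerA.
Qed.

(** Slicing identifies [starmul] with the product of a direct product of rings
    of real matrices, where inverses are taken componentwise. *)
Lemma star_invertible_slice (p : nat) (A : 'M['M[R]_n]_p) :
  (forall i j, slice A i j \in unitmx) -> star_invertible A.
Proof.
move=> uA; exists (\matrix_(r, s) \matrix_(i, j) invmx (slice A i j) r s).
have sB i j : slice (\matrix_(r, s) \matrix_(i, j) invmx (slice A i j) r s) i j
    = invmx (slice A i j) by apply/matrixP => r s; rewrite !mxE.
split; apply: sliceP => i j; rewrite slice_starmul slice_starid sB.
  exact: mulmxV.
exact: mulVmx.
Qed.

(** Stated without inverses, so that a candidate for Z can be recognised by a
    multiplication. *)
Lemma slice_Zmx (p : nat) t (A : 'M['M[R]_n]_p) i j :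
  star_invertible (Zden t A) ->
  slice (Zmx t A) i j *m (1%:M - (t *: slice A j i) *m (t *: slice A i j))
  = t *: slice A i j.
Proof.
move=> [B HB]; have [_ HV] : is_starinv (Zden t A) (starinv (Zden t A)).
  by apply: (@xgetPex _ 0 [set C | is_starinv _ C]%classic); exists B.
rewrite slice_starmul slice_bscale -slice_Zden -mulmxA -slice_starmul.
by rewrite HV slice_starid mulmx1.
Qed.

(** The analogue for weighted time-evolving networks of the deformed graph
    Laplacian (1 - t^2)^-1 (I - t A + t^2 (D - I)) of a simple graph, to which
    it specialises for one unweighted loopless undirected frame. *)
Definition nbt_laplacian (p : nat) t (A : 'M['M[R]_n]_p) : 'M['M[R]_n]_p :=
  1%:M - Zmx t A + stardd (bscale t A *m Zmx t A).

(** Slice by slice, Z_new is determined by Z_new (1 - T_ji T_ij) = T_ij, so it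
    suffices to multiply the candidate on the right by the triangular matrix
    1 - T_ji T_ij. *)
Lemma Zmx_block (p : nat) t (A : 'M['M[R]_n]_p) (B : 'M['M[R]_n]_1)
    (Anew := block_mx A (bcol p B) 0 B) :
  star_invertible (Zden t A) -> star_invertible (Zden t B) ->
  (forall i j, slice (Zden t Anew) i j \in unitmx) ->
  Zmx t Anew =
  block_mx (Zmx t A)
    (starmul (starmul (Zmx t A) (bscale t (startr A))) (bcol p (Zmx t B))
     + starmul (starmul (Zmx t A) (bscale t (startr (bcol p B)))) (Zmx t B)
     + bcol p (Zmx t B))
    0 (Zmx t B).
Proof.
move=> iA iB unew; have inew := star_invertible_slice unew.
apply: sliceP => i j; apply: (can_inj (mulmxK (unew i j))).
rewrite slice_Zden slice_Zmx // /Anew !slice_block.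
have := slice_Zmx i j iB; have := slice_Zmx i j iA.
move: (Zmx t A) (Zmx t B) => ZA ZB.
rewrite !(sliceD, slice_starmul, slice_bscale, slice_startr, slice_bcol).
rewrite !slice0 !scale_block_mx !mulmx_block (@scalar_mx_block _ p 1 1).
rewrite opp_block_mx add_block_mx mulmx_block !scalemxAr.
rewrite ?(scaler0, mul0mx, mulmx0, addr0, add0r, sub0r, oppr0).
move: (slice ZA i j) (slice ZB i j) (t *: slice A i j) (t *: slice A j i)
  (t *: slice B i j) (t *: slice B j i) => za zb a a' b b' Ea Eb.
congr block_mx; rewrite ?Ea ?Eb //.
have zbK m (x : 'M[R]_(m, 1)) : x *m zb *m (1%:M - b' *m b) = x *m b.
  by rewrite -mulmxA Eb.
rewrite mulmxN mulmxDr !mulmxDl !mulmxA !zbK.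
exact/esym/addKr.
Qed.

Lemma stardd0 (p q : nat) : stardd (0 : 'M['M[R]_n]_(p, q)) = 0.
Proof. by apply: sliceP => i j; rewrite slice_stardd slice0 if_same. Qed.

Lemma starddD (p q : nat) (A B : 'M['M[R]_n]_(p, q)) :
  stardd (A + B) = stardd A + stardd B.
Proof.
apply: sliceP => i j; rewrite sliceD !slice_stardd sliceD.
by case: eqP; rewrite ?addr0.
Qed.

Lemma stardd_block (p1 p2 q1 q2 : nat) (Aul : 'M['M[R]_n]_(p1, q1)) Aur Adl
    (Adr : 'M['M[R]_n]_(p2, q2)) :
  stardd (block_mx Aul Aur Adl Adr) =
  block_mx (stardd Aul) (stardd Aur) (stardd Adl) (stardd Adr).
Proof.
apply: sliceP => i j; rewrite slice_stardd !slice_block !slice_stardd.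
by case: eqP; rewrite ?block_mx0.
Qed.

Lemma bscale_block (p1 p2 q1 q2 : nat) t (Aul : 'M['M[R]_n]_(p1, q1)) Aur Adl
    (Adr : 'M['M[R]_n]_(p2, q2)) :
  bscale t (block_mx Aul Aur Adl Adr) =
  block_mx (bscale t Aul) (bscale t Aur) (bscale t Adl) (bscale t Adr).
Proof.
apply: sliceP => i j; rewrite slice_bscale !slice_block.
by rewrite scale_block_mx !slice_bscale.
Qed.

Lemma bscale0 (p q : nat) t : bscale t (0 : 'M['M[R]_n]_(p, q)) = 0.
Proof. by apply: sliceP => i j; rewrite slice_bscale !slice0 scaler0. Qed.

Lemma nbt_laplacian_block (p : nat) t (A : 'M['M[R]_n]_p) (B : 'M['M[R]_n]_1)
    (Anew := block_mx A (bcol p B) 0 B) :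
  star_invertible (Zden t A) -> star_invertible (Zden t B) ->
  (forall i j, slice (Zden t Anew) i j \in unitmx) ->
  nbt_laplacian t Anew =
  block_mx (nbt_laplacian t A) (Xmx t A B) 0 (nbt_laplacian t B).
Proof.
move=> iA iB unew; rewrite /nbt_laplacian Zmx_block // /Anew.
rewrite bscale_block mulmx_block bscale0 !mulmx0 !mul0mx !addr0 !add0r.
rewrite stardd_block stardd0.
rewrite (@scalar_mx_block _ p 1 1) opp_block_mx !add_block_mx starddD.
rewrite !(add0r, oppr0) /Xmx; congr block_mx.
rewrite !opprD; move: (stardd _) (stardd _) => d1 d2.
by rewrite addrA; congr (_ + _); rewrite addrAC.
Qed.

(** The linear algebra behind the inverse of Psi.  The two equations that link
    [f u v] and [f v u] are solved for [f u v], which expresses it through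
    [F u] and [F v] alone; summing over [u] eliminates [f]. *)
Lemma mul_nbt_laplacian_arcs (p : nat) t (A : 'M['M[R]_n]_p)
    (F : 'I_n -> 'M[R]_p) (f : 'I_n -> 'I_n -> 'M[R]_p) (D : 'I_n -> 'M[R]_p) :
  (forall i j, slice (Zden t A) i j \in unitmx) ->
  (forall v, F v = D v + \sum_u f u v) ->
  (forall u v, f u v = (F u - f v u) *m (t *: slice A u v)) ->
  forall v, \sum_u F u *m slice (nbt_laplacian t A) u v = D v.
Proof.
move=> uA FE fE v; have iA := star_invertible_slice uA.
(* Eliminating [f v u] between the equations for (u, v) and (v, u). *)
have fZ u : f u v = F u *m slice (Zmx t A) u v
    - F v *m ((t *: slice A v u) *m slice (Zmx t A) u v).
  apply: (can_inj (mulmxK (uA u v))); rewrite mulmxBl -!mulmxA slice_Zden.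
  rewrite slice_Zmx // mulmxBr mulmx1 mulmxA.
  rewrite {1}fE mulmxBl {1}(fE v u) !mulmxBl !mulmxA.
  by rewrite opprB addrA addrAC addrK.
under eq_bigr => u _.
  rewrite /nbt_laplacian !sliceD sliceN slice1 slice_stardd mulmxDr mulmxBr.
  over.
rewrite big_split sumrB /=.
rewrite (bigD1 v) //= eqxx mulmx1 big1 ?addr0 => [|u /negPf->]; last first.
  by rewrite raddf0 mulmx0.
rewrite [X in _ + X](bigD1 v) //= eqxx.
rewrite [X in _ + (_ + X)]big1 ?addr0; last first.
  by move=> u /negPf->; rewrite mulmx0.
rewrite slice_mul mulmx_sumr -addrA [- _ + _]addrC -opprB.
have -> : \sum_u F u *m slice (Zmx t A) u v
    - \sum_u F v *m (slice (bscale t A) v u *m slice (Zmx t A) u v)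
    = \sum_u f u v.
  by rewrite -sumrB; apply: eq_bigr => u _; rewrite fZ slice_bscale.
by rewrite FE addrK.
Qed.

End Slices.

(** * Decomposing nonbacktracking walks by their last step *)

Section RconsTuple.
Variable T : Type.

Lemma tnth_rcons_lt (k : nat) (x : k.-tuple T) a (l : 'I_k.+1) (m : 'I_k) :
  l = m :> nat -> tnth [tuple of rcons x a] l = tnth x m.
Proof.
by move=> lm; rewrite !(tnth_nth a) /= nth_rcons size_tuple lm ltn_ord.
Qed.

Lemma tnth_rcons_last (k : nat) (x : k.-tuple T) a (l : 'I_k.+1) :
  l = k :> nat -> tnth [tuple of rcons x a] l = a.
Proof.
by move=> lk; rewrite (tnth_nth a) /= nth_rcons size_tuple lk ltnn eqxx.
Qed.

End RconsTuple.

(** Appending one node and one frame: the bijection that underlies the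
    recurrence on the length of walks. *)
Lemma rcons_tuple2_bij (T1 T2 : finType) (k m : nat) :
  bijective (fun w : (k.-tuple T1 * m.-tuple T2) * (T1 * T2) =>
    ([tuple of rcons w.1.1 w.2.1], [tuple of rcons w.1.2 w.2.2])).
Proof.
apply: inj_card_bij => [[[x f] [a b]] [[y g] [c d]] /= [xy fg]|].
  have [/val_inj-> ->] := rcons_inj xy.
  by have [/val_inj-> ->] := rcons_inj fg.
by rewrite !card_prod !card_tuple !expnSr mulnACA.
Qed.

Lemma forall_ord_recr (k : nat) (P : pred 'I_k.+1) :
  [forall l, P l] = [forall l, P (widen_ord (leqnSn k) l)] && P ord_max.
Proof.
apply/forallP/andP => [H|[/forallP H Pmax] l].
  by split=> //; apply/forallP.
have [lk|kl] := ltnP l k.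
  by rewrite (_ : l = widen_ord (leqnSn k) (Ordinal lk)) //; exact: val_inj.
rewrite (_ : l = ord_max) //; apply: val_inj; apply/eqP.
by rewrite eqn_leq kl -ltnS ltn_ord.
Qed.

Section Walks.
Variables (R : realType) (n M : nat) (G : network R n M).

Lemma wsrc_rcons (k : nat) (x : k.+1.-tuple 'I_n) a (l : 'I_k) :
  wsrc [tuple of rcons x a] (widen_ord (leqnSn k) l) = wsrc x l.
Proof. exact: tnth_rcons_lt. Qed.

Lemma wsrc_rcons_last (k : nat) (x : k.+1.-tuple 'I_n) a :
  wsrc [tuple of rcons x a] ord_max = tnth x ord_max.
Proof. exact: tnth_rcons_lt. Qed.

Lemma wtgt_rcons (k : nat) (x : k.+1.-tuple 'I_n) a (l : 'I_k) :
  wtgt [tuple of rcons x a] (widen_ord (leqnSn k) l) = wtgt x l.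
Proof. exact: tnth_rcons_lt. Qed.

Lemma wtgt_rcons_last (k : nat) (x : k.+1.-tuple 'I_n) a :
  wtgt [tuple of rcons x a] ord_max = a.
Proof. exact: tnth_rcons_last. Qed.

Lemma walk_weight_rcons (k : nat) (x : k.+1.-tuple 'I_n) (f : k.-tuple 'I_M)
    a q :
  walk_weight G [tuple of rcons x a] [tuple of rcons f q] =
  walk_weight G x f * wd_weight (G q) (tnth x ord_max) a.
Proof.
rewrite /walk_weight big_ord_recr wsrc_rcons_last wtgt_rcons_last.
rewrite tnth_rcons_last //; congr (_ * _); apply: eq_bigr => l _.
by rewrite wsrc_rcons wtgt_rcons (@tnth_rcons_lt _ _ f q _ l).
Qed.

Lemma is_walk_rcons (k : nat) (x : k.+2.-tuple 'I_n) (f : k.+1.-tuple 'I_M)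
    a q :
  is_walk G [tuple of rcons x a] [tuple of rcons f q] =
  [&& is_walk G x f, wd_edge (G q) (tnth x ord_max) a &
      (tnth f ord_max <= q)%N].
Proof.
rewrite /is_walk forall_ord_recr wsrc_rcons_last wtgt_rcons_last.
rewrite tnth_rcons_last //= map_rcons.
rewrite (_ : sorted leq (rcons _ _) =
  sorted leq [seq val s | s <- f] && (tnth f ord_max <= q)%N); last first.
  case: f => [[//|b f] /= size_f]; rewrite rcons_path (tnth_nth b) /=.
  rewrite last_map -(last_cons b b) -nth_last /=.
  by move: size_f => /eqP[->].
rewrite (@eq_forallb _ _
  (fun l => wd_edge (G (tnth f l)) (wsrc x l) (wtgt x l))); last first.
  by move=> l; rewrite wsrc_rcons wtgt_rcons (@tnth_rcons_lt _ _ f q _ l).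
by rewrite -!andbA; congr andb; rewrite andbCA.
Qed.

(** Indexing by natural numbers avoids transporting ordinals when a node is
    appended. *)
Lemma backtrackingP (k : nat) (x : k.+1.-tuple 'I_n) (i0 : 'I_n) :
  reflect (exists2 l, (l.+2 <= k)%N & nth i0 x l = nth i0 x l.+2)
    (backtracking x).
Proof.
apply: (iffP existsP) => [[a /existsP[b /andP[/eqP ab /eqP xab]]]|[l lk xl]].
  exists a; first by rewrite -ab -ltnS.
  by rewrite -ab -!tnth_nth.
exists (inord l); apply/existsP; exists (inord l.+2).
have lk2 : (l < k.+1)%N by rewrite ltnW // ltnS ltnW.
by rewrite !(tnth_nth i0) !inordK // eqxx xl eqxx.
Qed.

Lemma backtracking_rcons (k : nat) (x : k.+2.-tuple 'I_n) a :
  backtracking [tuple of rcons x a] =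
  backtracking x || (wsrc x ord_max == a).
Proof.
rewrite /wsrc (tnth_nth a) /=.
apply/(backtrackingP _ a)/orP => [[l]|[/(backtrackingP _ a)[l lk xl]|/eqP xa]].
- rewrite leq_eqVlt !ltnS /= !nth_rcons size_tuple !ltnS.
  case: eqP => [[->] _|_ /= lk].
    by rewrite ltnn leqnSn => ->; right.
  rewrite lk (leq_trans (ltnW lk)) // => xl; left.
  by apply/(backtrackingP _ a); exists l.
- exists l; first exact: leqW.
  rewrite !nth_rcons size_tuple (_ : (l.+2 < k.+2)%N) //.
  by rewrite (_ : (l < k.+2)%N) // ltnW // ltnW.
exists k => //=; rewrite !nth_rcons size_tuple ltnn eqxx.
by rewrite ltnS leqnSn.
Qed.

(** The entry of P_k that belongs to walks whose last step goes from u to v.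
    For k = 0 there is no last step; the value 0 makes the recurrences below
    hold from the start. *)
Definition Parc (r s : 'I_M) (i u v : 'I_n) (k : nat) : R :=
  if k is k'.+1 then
    \sum_(w : (k'.+2.-tuple 'I_n * k'.+1.-tuple 'I_M)%type |
            [&& is_walk G w.1 w.2, ~~ backtracking w.1,
                tnth w.1 ord0 == i, tnth w.1 ord_max == v,
                (r <= tnth w.2 ord0)%N, tnth w.2 ord_max == s &
                wsrc w.1 ord_max == u])
        walk_weight G w.1 w.2
  else 0.

Lemma walk_weight_ge0 (k : nat) (x : k.+1.-tuple 'I_n) (f : k.-tuple 'I_M) :
  is_walk G x f -> 0 <= walk_weight G x f.
Proof.
move=> /andP[/forallP Gx _]; apply: prodr_ge0 => l _.
exact: ltW (wd_weight_gt0 (Gx l)).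
Qed.

Lemma Parc_ge0 r s i u v k : 0 <= Parc r s i u v k.
Proof.
case: k => [|k] /=; first exact: lexx.
by apply: sumr_ge0 => w /andP[/walk_weight_ge0].
Qed.

Lemma Pmx_Parc r s i v k :
  Pmx G k.+1 r s i v = \sum_u Parc r s i u v k.+1.
Proof.
rewrite !mxE (partition_big (fun w => wsrc w.1 ord_max) predT) //=.
by apply: eq_bigr => u _; apply: eq_bigl => w; rewrite -!andbA.
Qed.

Lemma Parc1 r s i u v : Parc r s i u v 1 = (i == u)%:R * tadj G r s u v.
Proof.
have walk1 : is_walk G [tuple i; v] [tuple s] = wd_edge (G s) i v.
  rewrite /is_walk andbT.
  by apply/forallP/idP => [/(_ ord0)|Gs l]; rewrite ?ord1.
have nbt1 : backtracking [tuple i; v] = false.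
  by apply/(backtrackingP _ i) => -[].
rewrite /Parc big_mkcond (bigD1 ([tuple i; v], [tuple s])) //= big1 ?addr0.
  rewrite walk1 nbt1 /walk_weight big_ord1.
  rewrite -[tnth [tuple i; v] ord0]/i -[tnth [tuple i; v] ord_max]/v.
  rewrite -[tnth [tuple s] ord0]/s -[tnth [tuple s] ord_max]/s.
  rewrite -[wsrc [tuple i; v] ord0]/i -[wsrc [tuple i; v] ord_max]/i.
  rewrite -[wtgt [tuple i; v] ord0]/v !eqxx !mxE /=.
  by case: eqP => [->|_]; case: (leqP r s) => _; rewrite !mxE;
     case: wd_edge => //=; rewrite ?(mul0r, mul1r, mulr0).
case=> x f; case: ifP => // /and5P[_ _ /eqP xi /eqP xv] /=.
rewrite andbA andbAC => /andP[_ /eqP fs] /negP[]; apply/eqP; congr pair.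
  apply: eq_from_tnth => l; have [->|->] : l = ord0 \/ l = ord_max.
    by case: l => [[|[|//]] ?]; [left|right]; apply: val_inj.
  - by rewrite xi.
  - by rewrite xv.
apply: eq_from_tnth => l; rewrite !ord1 -fs; congr tnth; exact: val_inj.
Qed.

(** Deleting the last step of a walk leaves a nonbacktracking walk from i to u
    whose last step does not come from v, and any such walk whose last frame q
    is at most s can be prolonged if (u, v) is an edge of the frame s.  The
    block (q, s) of [tadj] is zero unless q <= s, so the monotonicity of the
    frames is accounted for by the sum. *)
Lemma Parc_rec r s i u v k :
  Parc r s i u v k.+2 =
  \sum_q (Pmx G k.+1 r q i u - Parc r q i v u k.+1) * tadj G q s u v.
Proof.
rewrite /Parc big_mkcond.
rewrite (reindex _ (onW_bij _ (@rcons_tuple2_bij _ _ _ _))) /=.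
pose base (w : k.+2.-tuple 'I_n * k.+1.-tuple 'I_M) :=
  [&& is_walk G w.1 w.2, ~~ backtracking w.1, tnth w.1 ord0 == i,
      tnth w.1 ord_max == u, (r <= tnth w.2 ord0)%N & wsrc w.1 ord_max != v].
(* The appended node and frame are forced to be v and s. *)
transitivity (\sum_(w | base w)
    walk_weight G w.1 w.2 * tadj G (tnth w.2 ord_max) s u v).
  rewrite [RHS]big_mkcond -(pair_bigA _
    (fun (w : k.+2.-tuple 'I_n * k.+1.-tuple 'I_M) (aq : 'I_n * 'I_M) =>
    if [&& is_walk G [tuple of rcons w.1 aq.1] [tuple of rcons w.2 aq.2],
       ~~ backtracking [tuple of rcons w.1 aq.1],
       tnth [tuple of rcons w.1 aq.1] ord0 == i,
       tnth [tuple of rcons w.1 aq.1] ord_max == v,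
       (r <= tnth [tuple of rcons w.2 aq.2] ord0)%N,
       tnth [tuple of rcons w.2 aq.2] ord_max == s &
       wsrc [tuple of rcons w.1 aq.1] ord_max == u]
    then walk_weight G [tuple of rcons w.1 aq.1] [tuple of rcons w.2 aq.2]
    else 0)) /=.
  apply: eq_bigr => -[x f] _ /=; rewrite (bigD1 (v, s)) //= big1 ?addr0.
    rewrite is_walk_rcons backtracking_rcons walk_weight_rcons wsrc_rcons_last.
    rewrite !(tnth_rcons_last _ _ (l := ord_max)) // !eqxx.
    rewrite !(@tnth_rcons_lt _ _ _ _ ord0 ord0) // /base /= !mxE.
    case: is_walk; case: backtracking; case: (tnth x ord0 == i);
      rewrite ?(andbF, andbT) //=.
    have [->|_] := eqVneq (tnth x ord_max) u; rewrite ?(andbF, andbT) //=.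
    case: (r <= _)%N; case: (wsrc _ _ == v); rewrite ?(andbF, andbT) //=.
    case: (leqP _ s) => _; rewrite !mxE ?(andbF, andbT, mulr0) //.
    by case: ifP; rewrite ?mulr0.
  case=> a q /= naq; case: ifP => // /and5P[_ _ _ av /and3P[_ qs _]].
  move: naq; rewrite -(eqP av) -(eqP qs).
  by rewrite !(tnth_rcons_last _ _ (l := ord_max)) // eqxx.
(* Sorting the shortened walks by their last frame q. *)
transitivity (\sum_(w | base w) \sum_q (tnth w.2 ord_max == q)%:R *
    (walk_weight G w.1 w.2 * tadj G q s u v)).
  apply: eq_bigr => w _; rewrite (bigD1 (tnth w.2 ord_max)) //= eqxx mul1r.
  by rewrite big1 ?addr0 // => q; rewrite eq_sym => /negPf->; rewrite mul0r.
rewrite exchange_big; apply: eq_bigr => q _ /=.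
under eq_bigr do rewrite mulrA.
rewrite -mulr_suml !mxE; congr (_ * _).
rewrite big_mkcond [X in _ = X - _]big_mkcond [X in _ = _ - X]big_mkcond.
rewrite -sumrB; apply: eq_bigr => -[x f] _; rewrite /base /=.
case: is_walk; case: backtracking; case: (_ == i); case: (_ == u);
  case: (r <= _)%N; case: (_ == v); case: (_ == q);
  by rewrite /= ?(subr0, subrr, mul0r, mul1r).
Qed.

End Walks.

Arguments Parc : simpl never.

(** * Adding a final frame *)

Section BlockTriangular.
Variables (R : realType) (p : nat).
Implicit Types X Y : 'M[R]_(p + 1).

(** The upper right block is left unspecified: only the diagonal blocks of the
    new walk matrices are known in advance. *)
Definition block_upper X (B : 'M[R]_p) (C : 'M[R]_1) : Prop :=
  exists U, X = block_mx B U 0 C.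

Lemma block_upperB X1 B1 C1 X2 B2 C2 :
  block_upper X1 B1 C1 -> block_upper X2 B2 C2 ->
  block_upper (X1 - X2) (B1 - B2) (C1 - C2).
Proof.
move=> [U1 ->] [U2 ->]; exists (U1 - U2).
by rewrite opp_block_mx add_block_mx subr0.
Qed.

Lemma block_upper_mul X1 B1 C1 X2 B2 C2 :
  block_upper X1 B1 C1 -> block_upper X2 B2 C2 ->
  block_upper (X1 *m X2) (B1 *m B2) (C1 *m C2).
Proof.
move=> [U1 ->] [U2 ->]; exists (B1 *m U2 + U1 *m C2).
by rewrite mulmx_block !mulmx0 !mul0mx !addr0 add0r.
Qed.

Lemma block_upper_sum (I : finType) (X : I -> 'M[R]_(p + 1)) B C :
  (forall i, block_upper (X i) (B i) (C i)) ->
  block_upper (\sum_i X i) (\sum_i B i) (\sum_i C i).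
Proof.
move=> XBC; apply: (big_ind3 block_upper) => //.
  by exists 0; rewrite block_mx0.
move=> X1 B1 C1 X2 B2 C2 [U1 ->] [U2 ->]; exists (U1 + U2).
by rewrite add_block_mx addr0.
Qed.

Lemma block_upper_block B U C : block_upper (block_mx B U 0 C) B C.
Proof. by exists U. Qed.

End BlockTriangular.

Section WalkMatrices.
Variables (R : realType) (n : nat).

Definition Parc_mx M (G : network R n M) k i u v : 'M[R]_M :=
  \matrix_(r, s) Parc G r s i u v k.

Lemma Parc_mx0 M (G : network R n M) i u v : Parc_mx G 0 i u v = 0.
Proof. by apply/matrixP => r s; rewrite !mxE. Qed.

(** For k = 0 the convention on [Parc] and P_0 = I make the formula count the
    walks of length 1, so that one recurrence covers all lengths. *)
Lemma Parc_mx_rec M (G : network R n M) k i u v :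
  Parc_mx G k.+1 i u v =
  (slice (Pmx G k) i u - Parc_mx G k i v u) *m slice (tadj G) u v.
Proof.
case: k => [|k]; last first.
  apply/matrixP => r s; rewrite mxE Parc_rec [RHS]mxE.
  by apply: eq_bigr => q _; rewrite !mxE.
rewrite Parc_mx0 subr0 slice1 mul_scalar_mx.
by apply/matrixP => r s; rewrite mxE Parc1 !mxE.
Qed.

Lemma slice_Pmx_Parc_mx M (G : network R n M) k i v :
  slice (Pmx G k.+1) i v = \sum_u Parc_mx G k.+1 i u v.
Proof.
apply/matrixP => r s; rewrite mxE Pmx_Parc summxE.
by apply: eq_bigr => u _; rewrite mxE.
Qed.

(** The recurrence [Parc_mx_rec] builds the walk matrices from [tadj] by sums,
    differences and products, which respect the block triangular shape and act
    separately on the diagonal blocks. *)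
Lemma Pmx_add_frame M (G : network R n M) (H : wdigraph R n) k :
  (forall i u v, block_upper (Parc_mx (add_frame G H) k i u v)
     (Parc_mx G k i u v) (Parc_mx (one_frame H) k i u v)) /\
  (forall i v, block_upper (slice (Pmx (add_frame G H) k) i v)
     (slice (Pmx G k) i v) (slice (Pmx (one_frame H) k) i v)).
Proof.
elim: k => [|k [IHl IHP]].
  split=> [i u v|i v].
    by exists 0; rewrite !Parc_mx0 block_mx0.
  by rewrite !slice1 (@scalar_mx_block _ M 1); apply: block_upper_block.
have IH i u v : block_upper (Parc_mx (add_frame G H) k.+1 i u v)
     (Parc_mx G k.+1 i u v) (Parc_mx (one_frame H) k.+1 i u v).
  rewrite !Parc_mx_rec; apply: block_upper_mul; first exact: block_upperB.
  by rewrite tadj_add_frame slice_block slice0; apply: block_upper_block.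
by split=> // i v; rewrite !slice_Pmx_Parc_mx; apply: block_upper_sum.
Qed.

End WalkMatrices.

(** * Generating functions and their inverses *)

Section EntrywiseConvergence.
Local Open Scope classical_set_scope.
Local Open Scope ring_scope.

Lemma cvg_mx_entriesP (T : topologicalType) (p q : nat)
    (u : nat -> 'M[T]_(p, q)) (L : 'M[T]_(p, q)) :
  (u k @[k --> \oo] --> L)%classic <->
  forall i j, (u k i j @[k --> \oo] --> L i j)%classic.
Proof.
split=> [uL i j A nA|uL A [P nP PA]].
  have : nbhs L [set B | A (B i j)]%classic.
    exists (fun i' j' => if (i' == i) && (j' == j) then A else setT).
      move=> i' j'.
      by case: eqP => [->|_]; case: eqP => [->|_] //=; apply: filterT.
    by move=> B /(_ i j); rewrite !eqxx.
  by move=> /uL.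
have : \forall k \near \oo, forall i j, P i j (u k i j).
  apply: filter_forall => i; apply: filter_forall => j; exact: uL (nP i j).
by apply: filterS => k Pu; apply: PA.
Qed.

Lemma cvg_sum_finType (R : realType) (I : finType)
    (f : I -> nat -> R) (l : I -> R) :
  (forall i, (f i @ \oo --> l i)%classic) ->
  ((\sum_i f i k) @[k --> \oo] --> \sum_i l i)%classic.
Proof. by move=> fl; apply: (cvg_big add_continuous) => i _; apply: fl. Qed.

End EntrywiseConvergence.

Section GeneratingFunction.
Variables (R : realType) (n : nat).
Local Open Scope classical_set_scope.
Local Open Scope ring_scope.

Definition Pmx_series M (G : network R n M) t r s i v : nat -> R :=
  series (fun k => t ^+ k * Pmx G k r s i v).

Definition Parc_series M (G : network R n M) t r s i u v : nat -> R :=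
  series (fun k => t ^+ k * Parc G r s i u v k).

Lemma Psi_partialE M (G : network R n M) t K r s i v :
  Psi_partial G t K r s i v = Pmx_series G t r s i v K.
Proof.
rewrite /Psi_partial /Pmx_series /series /= !summxE.
by apply: eq_bigr => k _; rewrite !mxE.
Qed.

Lemma Psi_partial_cvgP M (G : network R n M) t (L : 'M['M[R]_n]_M) :
  (Psi_partial G t @ \oo --> L)%classic <->
  forall r s i v, (Pmx_series G t r s i v @ \oo --> L r s i v)%classic.
Proof.
split=> [/cvg_mx_entriesP cL r s i v|cL].
  have /cvg_mx_entriesP/(_ i v) := cL r s.
  by under eq_fun do rewrite Psi_partialE.
apply/cvg_mx_entriesP => r s; apply/cvg_mx_entriesP => i v.
by under eq_fun do rewrite Psi_partialE; exact: cL.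
Qed.

Lemma Psi_cvg M (G : network R n M) t : Psi_converges G t ->
  forall r s i v, (Pmx_series G t r s i v @ \oo --> Psi G t r s i v)%classic.
Proof. by move=> cG; apply/Psi_partial_cvgP. Qed.

Arguments Psi_cvg {M G t} _ r s i v.

(** Working entry by entry reduces uniqueness of the limit to that of limits of
    real sequences. *)
Lemma Psi_eq_lim M (G : network R n M) t (L : 'M['M[R]_n]_M) :
  (forall r s i v, (Pmx_series G t r s i v @ \oo --> L r s i v)%classic) ->
  Psi_converges G t /\ Psi G t = L.
Proof.
move=> cL; have cG : Psi_converges G t.
  by apply/cvg_ex; exists L; apply/Psi_partial_cvgP.
split=> //; apply/matrixP => r s; apply/matrixP => i v.
have c1 := Psi_cvg cG r s i v.
exact: (cvg_unique _ c1 (cL r s i v)).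
Qed.

Lemma Psi_add_frame M (G : network R n M) (H : wdigraph R n) t :
  Psi_converges (add_frame G H) t ->
  [/\ Psi_converges G t, Psi_converges (one_frame H) t &
      exists U, Psi (add_frame G H) t =
        block_mx (Psi G t) U 0 (Psi (one_frame H) t)].
Proof.
move=> cN; have cE := Psi_cvg cN.
set P := Psi (add_frame G H) t in cE *.
have [cG ->] : Psi_converges G t /\ Psi G t = ulsubmx P.
  apply: Psi_eq_lim => r s i v; rewrite !mxE.
  have -> : Pmx_series G t r s i v =
      Pmx_series (add_frame G H) t (lshift 1 r) (lshift 1 s) i v => //.
  apply/funext => K; apply: eq_bigr => k _; congr (_ * _).
  have [_ /(_ i v)[U]] := Pmx_add_frame G H k.
  move=> /matrixP/(_ (lshift 1 r) (lshift 1 s)).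
  by rewrite block_mxEul !mxE.
have [c1 ->] : Psi_converges (one_frame H) t /\ Psi (one_frame H) t = drsubmx P.
  apply: Psi_eq_lim => r s i v; rewrite !mxE.
  have -> : Pmx_series (one_frame H) t r s i v =
      Pmx_series (add_frame G H) t (rshift M r) (rshift M s) i v => //.
  apply/funext => K; apply: eq_bigr => k _; congr (_ * _).
  have [_ /(_ i v)[U]] := Pmx_add_frame G H k.
  move=> /matrixP/(_ (rshift M r) (rshift M s)).
  by rewrite block_mxEdr !mxE.
split=> //; exists (ursubmx P); rewrite -[LHS]submxK; congr block_mx.
apply/matrixP => r s; apply/matrixP => i v; rewrite !mxE.
have c0 : (Pmx_series (add_frame G H) t (rshift M r) (lshift 1 s) i v @ \oo
    --> (0 : R))%classic.
  rewrite (_ : Pmx_series _ _ _ _ _ _ = fun=> 0); first exact: cvg_cst.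
  apply/funext => K; apply: big1 => k _.
  have [_ /(_ i v)[U]] := Pmx_add_frame G H k.
  move=> /matrixP/(_ (rshift M r) (lshift 1 s)).
  by rewrite block_mxEdl !mxE => ->; rewrite mulr0.
exact: (cvg_unique _ (cE _ _ _ _) c0).
Qed.

Section Resolvent.
Variables (M : nat) (G : network R n M) (t : R).
Hypothesis t_ge0 : 0 <= t.
Hypothesis cG : Psi_converges G t.

Definition Psi_arc r s i u v := limn (Parc_series G t r s i u v).

(** Comparison of series with nonnegative terms: the walks with a given last
    step are among all walks. *)
Lemma Parc_series_cvg r s i u v :
  (Parc_series G t r s i u v @ \oo --> Psi_arc r s i u v)%classic.
Proof.
apply: (@series_le_cvg _ (fun k => t ^+ k * Parc G r s i u v k)
  (fun k => t ^+ k * Pmx G k r s i v)).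
- by move=> k; rewrite mulr_ge0 ?exprn_ge0 // Parc_ge0.
- case=> [|k]; rewrite mulr_ge0 ?exprn_ge0 //.
    by rewrite !mxE; case: (r == s); rewrite !mxE ?ler0n.
  by rewrite Pmx_Parc sumr_ge0 // => u' _; exact: Parc_ge0.
- case=> [|k]; rewrite ler_wpM2l ?exprn_ge0 //.
    by rewrite !mxE; case: (r == s); rewrite !mxE ?ler0n.
  rewrite Pmx_Parc (bigD1 u) // lerDl sumr_ge0 // => u' _; exact: Parc_ge0.
by apply/cvg_ex; exists (Psi G t r s i v); exact: Psi_cvg.
Qed.

Arguments Parc_series_cvg r s i u v : clear implicits.

Lemma Parc_series_shift r s i u v K : Parc_series G t r s i u v K.+1 =
  \sum_(0 <= k < K) t ^+ k.+1 * Parc G r s i u v k.+1.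
Proof.
by rewrite /Parc_series /series /= big_nat_recl // {1}/Parc mulr0 add0r.
Qed.

Lemma Parc_seriesS r s i u v K : Parc_series G t r s i u v K.+1 =
  \sum_q (Pmx_series G t r q i u K - Parc_series G t r q i v u K)
     * (t * tadj G q s u v).
Proof.
rewrite Parc_series_shift.
under [RHS]eq_bigr do rewrite -sumrB mulr_suml.
rewrite exchange_big; apply: eq_bigr => k _ /=.
have /matrixP/(_ r s) := Parc_mx_rec G k i u v; rewrite [LHS]mxE => ->.
rewrite mxE mulr_sumr; apply: eq_bigr => q _.
by rewrite !mxE exprSr -mulrBr mulrACA.
Qed.

Lemma Pmx_seriesS r s i v K : Pmx_series G t r s i v K.+1 =
  (1%:M : 'M['M[R]_n]_M) r s i v + \sum_u Parc_series G t r s i u v K.+1.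
Proof.
rewrite /Pmx_series /series [LHS]big_nat_recl // expr0 mul1r; congr (_ + _).
under [RHS]eq_bigr do rewrite Parc_series_shift.
by rewrite exchange_big; apply: eq_bigr => k _; rewrite Pmx_Parc mulr_sumr.
Qed.

(** Passing to the limit in [Parc_seriesS]; the shift of the index is harmless
    because [Parc] vanishes for length 0. *)
Lemma Psi_arc_rec r s i u v : Psi_arc r s i u v =
  \sum_q (Psi G t r q i u - Psi_arc r q i v u) * (t * tadj G q s u v).
Proof.
have c1 : Parc_series G t r s i u v k.+1 @[k --> \oo] --> Psi_arc r s i u v.
  by rewrite cvg_shiftS; apply: Parc_series_cvg.
apply: (cvg_unique _ c1) => //=; rewrite (funext (Parc_seriesS r s i u v)).
apply: cvg_sum_finType => q; apply: cvgMl; apply: cvgB; first exact: Psi_cvg.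
exact: Parc_series_cvg.
Qed.

Lemma Psi_sum_arc r s i v : Psi G t r s i v =
  (1%:M : 'M['M[R]_n]_M) r s i v + \sum_u Psi_arc r s i u v.
Proof.
have c1 : Pmx_series G t r s i v k.+1 @[k --> \oo] --> Psi G t r s i v.
  by rewrite cvg_shiftS; apply: Psi_cvg.
apply: (cvg_unique _ c1) => //=; rewrite (funext (Pmx_seriesS r s i v)).
apply: cvgD; first exact: cvg_cst.
by apply: cvg_sum_finType => u; rewrite cvg_shiftS; apply: Parc_series_cvg.
Qed.

Lemma Psi_mul_nbt_laplacian :
  (forall i j, slice (Zden t (tadj G)) i j \in unitmx) ->
  Psi G t *m nbt_laplacian t (tadj G) = 1%:M.
Proof.
move=> uZ; apply: sliceP => i v; rewrite slice_mul slice1.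
apply: (@mul_nbt_laplacian_arcs _ _ _ _ _ _
  (fun u v => \matrix_(r, s) Psi_arc r s i u v)
  (fun v => (i == v)%:R%:M) uZ) => {v}[v|u v].
  apply/matrixP => r s; rewrite -slice1 !mxE Psi_sum_arc summxE !mxE.
  by congr (_ + _); apply: eq_bigr => u _; rewrite mxE.
apply/matrixP => r s; rewrite !mxE Psi_arc_rec.
by apply: eq_bigr => q _; rewrite !mxE.
Qed.

End Resolvent.

End GeneratingFunction.

(** * Invertibility below the threshold *)

(** The slices of [tadj] are upper triangular, because time does not run
    backwards, so the determinant of 1 - T_ji T_ij is the product of the
    numbers 1 - t^2 (A_s)_ij (A_s)_ji over the frames s. *)
Lemma Zden_unit (R : realType) (n M : nat) (G : network R n M) t :
  (forall s i j, t ^+ 2 * (wd_adj (G s) i j * wd_adj (G s) j i) < 1) ->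
  forall i j, slice (Zden t (tadj G)) i j \in unitmx.
Proof.
move=> ht i j; rewrite unitmxE -det_tr slice_Zden.
set T := fun i j => t *: slice (tadj G) i j.
have T0 i' j' (r s : 'I_M) : (s < r)%N -> T i' j' r s = 0.
  by move=> sr; rewrite !mxE leqNgt sr mxE mulr0.
rewrite det_trig; last first.
  apply/is_trig_mxP => r s rs; rewrite !mxE big1.
    by rewrite subr0 -val_eqE (gtn_eqF rs).
  move=> q _; have [sq|qs] := ltnP q s; first by rewrite (T0 j i) ?mul0r.
  by rewrite (T0 i j) ?mulr0 // (leq_trans rs).
rewrite unitfE; apply/lt0r_neq0/prodr_gt0 => s _; rewrite !mxE (bigD1 s) //=.
rewrite big1 ?addr0 => [|q qs].
  rewrite eqxx mulr1n subr_gt0 !mxE leqnn mulrACA -expr2; exact: ht.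
move: qs; rewrite neq_ltn => /orP[qs|sq]; first by rewrite (T0 j i) ?mul0r.
by rewrite (T0 i j) ?mulr0.
Qed.

Lemma t0_frame_lt1 (R : realType) (n M : nat) (G : network R n M) t :
  0 < t -> (t%:E < t0 G)%E ->
  forall s i j, t ^+ 2 * (wd_adj (G s) i j * wd_adj (G s) j i) < 1.
Proof.
move=> t0lt; rewrite /t0 => ht s i j.
have le_max : wd_adj (G s) i j * wd_adj (G s) j i <= maxprod G.
  rewrite /maxprod.
  apply: le_trans (le_bigmax _ _ i); apply: le_trans (le_bigmax _ _ j).
  exact: le_bigmax.
have max0 : 0 <= maxprod G by apply: bigmax_ge_id.
apply: le_lt_trans (ler_wpM2l (exprn_ge0 2 (ltW t0lt)) le_max) _.
move: ht; case: eqP => [-> _|/eqP maxN0]; first by rewrite mulr0.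
have {maxN0}maxP : 0 < maxprod G by rewrite lt0r maxN0.
rewrite lte_fin powRN powR12_sqrt // => ht.
have sP : 0 < Num.sqrt (maxprod G) by rewrite sqrtr_gt0.
rewrite -[X in _ * X](sqr_sqrtr max0) -exprMn expr_lt1 //.
  by rewrite -ltr_pdivlMr // mul1r.
by rewrite mulr_ge0 // ltW.
Qed.

(** * Inversion by blocks *)

(** With a single block, a one-sided inverse is one of an ordinary square matrix
    over a field.  This is what turns Psi(A_N, t) L(A_N) = I into
    L(A_N) Psi(A_N, t) = I. *)
Lemma mulmx1C_block1 (R : realType) n (A B : 'M['M[R]_n]_1) :
  A *m B = 1%:M -> B *m A = 1%:M.
Proof.
move=> /matrixP/(_ 0 0); rewrite !mxE big_ord1 => AB.
apply/matrixP => r s; rewrite !ord1 !mxE big_ord1; exact: mulmx1C.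
Qed.

Theorem theorem3p14 (R : realType) (n N : nat) (hN : (2 <= N)%N)
    (G : network R n N.-1) (GN : wdigraph R n) (t : R)
    (ht_gt0 : 0 < t) (ht_lt : (t%:E < t0 (add_frame G GN))%E)
    (hconv : Psi_converges (add_frame G GN) t) :
  let Aold := tadj G in
  let AN := tadj (one_frame GN) in
  let X := Xmx t Aold AN in
  [/\ star_invertible (Zden t Aold),
      star_invertible (Zden t AN),
      Psi_converges G t,
      Psi_converges (one_frame GN) t &
      Psi (add_frame G GN) t =
      block_mx (Psi G t) (- (Psi G t *m X *m Psi (one_frame GN) t))
               0 (Psi (one_frame GN) t)].
Proof.
move=> Aold AN X; have t_ge0 := ltW ht_gt0.
have unew := t0_frame_lt1 ht_gt0 ht_lt.
have uold : forall i j, slice (Zden t Aold) i j \in unitmx.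
  apply: Zden_unit => s i j; move: (unew (lshift 1 s) i j).
  by rewrite /add_frame (unsplitK (inl _)).
have uN : forall i j, slice (Zden t AN) i j \in unitmx.
  apply: Zden_unit => s i j; move: (unew (rshift _ s) i j).
  by rewrite /add_frame (unsplitK (inr _)).
have {}unew := Zden_unit unew.
have [cG cN [U PsiE]] := Psi_add_frame hconv.
have iold := star_invertible_slice uold; have iN := star_invertible_slice uN.
split=> //; rewrite PsiE; congr block_mx.
have KN : nbt_laplacian t AN *m Psi (one_frame GN) t = 1%:M.
  exact: mulmx1C_block1 (Psi_mul_nbt_laplacian t_ge0 cN uN).
have := Psi_mul_nbt_laplacian t_ge0 hconv unew.
move: unew; rewrite PsiE tadj_add_frame => unew.
rewrite nbt_laplacian_block // mulmx_block (@scalar_mx_block _ _ 1).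
(* [UE] : Psi(A_old, t) X + U L(A_N) = 0. *)
move=> /eq_block_mx[_ UE _ _].
rewrite -/X -/Aold -/AN in UE.
rewrite -[LHS]mulmx1 -KN mulmxA -mulNmx; congr (_ *m _).
by apply/eqP; rewrite -addr_eq0 addrC UE.
Qed.
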